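(* For every integer $n\ge 0$, the non-overlapping partitions of $[n]=\{1,2,\ldots,n\}$ are in one-to-one correspondence with the permutations in $\mathcal{S}_n$ that avoid both $(a\text{-}bc)$ and $(ab\text{-}c)$. Hence $$|\mathcal{S}_n(a\text{-}bc,\,ab\text{-}c)|=B^*_n,$$ where $B^*_n$ is the $n$th Bessel number, i.e. the number of non-overlapping partitions of $[n]$.
   Context: $\mathcal{S}_n$ is the set of permutations of $[n]$, written as words $\pi=a_1a_2\cdots a_n$ (with $\mathcal{S}_0$ consisting of the empty word only). A (generalised) pattern is a word in distinct letters of the ordered alphabet $a<b<c<\cdots$ in which two adjacent letters may or may not be separated by a dash. A $p$-subword of $\pi$ is a subword $a_{i_1}a_{i_2}\cdots a_{i_k}$ ($i_1<i_2<\cdots<i_k$) whose letters are in the same relative order as the letters of $p$, and such that $i_{j+1}=i_j+1$ whenever the $j$th and $(j+1)$st letters of $p$ are not separated by a dash. So an $(a\text{-}bc)$-subword is a subword $a_ia_ja_{j+1}$ with $i<j$ and $a_i<a_j<a_{j+1}$, and an $(ab\text{-}c)$-subword is a subword $a_ia_{i+1}a_j$ with $i+1<j$ and $a_i<a_{i+1}<a_j$. A permutation avoids $p$ if it has no $p$-subword; $\mathcal{S}_n(p,q)$ is the set of permutations in $\mathcal{S}_n$ avoiding both $p$ and $q$. A partition of a set is a family of pairwise disjoint non-empty subsets (blocks) whose union is the set. Two blocks $A$ and $B$ of a partition overlap if $\min A<\min B<\max A<\max B$; a partition is non-overlapping if no pair of its blocks overlaps. *)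

(* Defs.v *)
From mathcomp Require Import all_boot all_fingroup.
Set Implicit Arguments. Unset Strict Implicit. Unset Printing Implicit Defensive.

(* The set [n] = {1, ..., n} is represented by 'I_n = {0, ..., n-1}: positions
   and values are shifted by one, which affects neither order nor adjacency.
   The letter of s : 'S_n in position i is s i. *)

(* The letters a < b < c < ... are the naturals 0 < 1 < 2 < ...; the entry j
   of [dashes] tells whether a dash separates the letters in positions j and
   j + 1, counting from 0. *)
Record gpattern := GPattern {
  letters : seq nat;
  dashes : seq bool;
  letters_uniq : uniq letters;
  size_dashes : size dashes = (size letters).-1
}.

Definition plen (p : gpattern) : nat := size (letters p).
Definition letter (p : gpattern) (j : nat) : nat := nth 0 (letters p) j.
Definition dash (p : gpattern) (j : nat) : bool := nth false (dashes p) j.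

(* [t] lists the positions i_1 < ... < i_k of the subword. *)
Definition subword (n : nat) (p : gpattern) (s : 'S_n)
    (t : {ffun 'I_(plen p) -> 'I_n}) : bool :=
  [&& [forall j : 'I_(plen p), forall k : 'I_(plen p),
         (j < k) ==> (t j < t k)],
      [forall j : 'I_(plen p), forall k : 'I_(plen p),
         (s (t j) < s (t k)) == (letter p j < letter p k)]
    & [forall j : 'I_(plen p), forall k : 'I_(plen p),
         ((k == j.+1 :> nat) && ~~ dash p j) ==> (t k == (t j).+1 :> nat)]].

Arguments subword {n} p s t.

Definition avoids (n : nat) (p : gpattern) (s : 'S_n) : bool :=
  ~~ [exists t, subword p s t].

Definition avoiders (n : nat) (p q : gpattern) : {set 'S_n} :=
  [set s : 'S_n | avoids p s && avoids q s].

Definition a_bc : gpattern :=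
  @GPattern [:: 0; 1; 2] [:: true; false] isT erefl.
Definition ab_c : gpattern :=
  @GPattern [:: 0; 1; 2] [:: false; true] isT erefl.

(* These are only meaningful for non-empty sets; blocks of a partition are
   non-empty. *)
Definition setmin (n : nat) (A : {set 'I_n}) : nat := \big[minn/n]_(i in A) i.
Definition setmax (n : nat) (A : {set 'I_n}) : nat := \max_(i in A) i.

Definition overlap (n : nat) (A B : {set 'I_n}) : bool :=
  [&& setmin A < setmin B, setmin B < setmax A & setmax A < setmax B].

Definition nonoverlapping (n : nat) (P : {set {set 'I_n}}) : bool :=
  [forall A in P, forall B in P, ~~ overlap A B].

Definition nonoverlapping_partitions (n : nat) : {set {set {set 'I_n}}} :=
  [set P : {set {set 'I_n}} | partition P [set: 'I_n] && nonoverlapping P].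

Definition bessel (n : nat) : nat := #|nonoverlapping_partitions n|.

(* Main.v *)
Require Import Defs.
From mathcomp Require Import all_boot all_fingroup.
From mathcomp Require Import zify.

(** A partition of [n] is the same thing as the map m sending each element to
    the least element of its block.  Read the elements from left to right: a
    block opens at its least element, closes at its greatest one, and its other
    elements each choose one of the blocks open at that moment.

    Two blocks overlap exactly when the one opened first closes first while the
    other is still open.  So a partition is non-overlapping if and only if
    every block that closes is the one opened last among those open
    ([nonoverlapping_fibres]): blocks close last in, first out.

    A permutation avoiding a-bc is a partition in disguise.  Its ascents can
    only start at left-to-right minima, so between two successive left-to-right
    minima the word decreases, and the word is obtained from a partition by
    writing the blocks in decreasing order of their minima, each block as its
    minimum followed by its other letters in decreasing order.  Each ascent
    then consists of the minimum and the maximum of a block, and an ab-c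
    subword is such an ascent followed by a letter of a block that opened
    earlier and is still open.  So the permutation also avoids ab-c if and only
    if every block that closes (and is not a singleton) is the one opened first
    among those open ([leftmin_fifo], [fifo_leftmin]): blocks close first in,
    first out.

    It remains to see that the two closing disciplines allow equally many
    partitions ([card_fifo_lifo]).  One switches from one to the other one
    closing element at a time.  If t closes the block opened last, rename the
    blocks open at t cyclically from t on: the last becomes the first, and each
    of the others becomes the next one.  Then t closes the block opened first,
    nothing changes before t, and since the renaming preserves the order of the
    blocks which stay open, the discipline followed after t is unchanged too.
    This renaming is injective, whence an inequality of cardinals; exchanging
    the roles of the two disciplines gives the other one. *)

Set Implicit Arguments.
Unset Strict Implicit.
Unset Printing Implicit Defensive.

(** * Partitions as maps to block minima *)

Definition minmap n (m : {ffun 'I_n -> 'I_n}) : bool :=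
  [forall i, (m i <= i) && (m (m i) == m i)].

(** A block is named by its least element o, and counts as open at t when it
    has elements both before t and at or after t. *)
Definition open_at n (m : {ffun 'I_n -> 'I_n}) (t : nat) : {set 'I_n} :=
  [set o : 'I_n | [&& o < t, m o == o & [exists k : 'I_n, (t <= k) && (m k == o)]]].

(** Singleton blocks are left out: they never overlap another block and never
    give rise to an ascent. *)
Definition closer n (m : {ffun 'I_n -> 'I_n}) (v : 'I_n) : bool :=
  (m v < v) && [forall k : 'I_n, (v < k) ==> (m k != m v)].

(** The two disciplines are exchanged by reversing the order; working with a
    direction b treats both at once. *)
Definition dir (b : bool) n : rel 'I_n :=
  fun x y => if b then x <= y else y <= x.
Arguments dir b {n} x y.

(** The intermediate stages: elements v >= t close the open block which is
    greatest for the direction b, elements v < t the one which is least.  Blocks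
    being named by their minima, [switched true n 0] is the last-in-first-out
    discipline and [switched false n 0] the first-in-first-out one. *)
Definition switched b n (t : nat) : {set {ffun 'I_n -> 'I_n}} :=
  [set m : {ffun 'I_n -> 'I_n} | minmap m &
     [forall v, closer m v ==>
        [forall o in open_at m v,
           if v < t then dir b (m v) o else dir b o (m v)]]].

Lemma minmapP n (m : {ffun 'I_n -> 'I_n}) :
  reflect ((forall i, m i <= i) /\ (forall i, m (m i) = m i)) (minmap m).
Proof.
apply: (iffP forallP) => [H|[H1 H2] i].
  by split=> i; case/andP: (H i) => // _ /eqP.
by rewrite H1 H2 eqxx.
Qed.

Lemma open_atP n (m : {ffun 'I_n -> 'I_n}) t (o : 'I_n) :
  reflect [/\ o < t, m o = o & exists2 k : 'I_n, t <= k & m k = o]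
    (o \in open_at m t).
Proof.
rewrite inE; apply: (iffP and3P) => [[lt /eqP mo /existsP[k /andP[lk /eqP mk]]]|].
  by split=> //; exists k.
case=> lt mo [k lk mk]; split=> //; first exact/eqP.
by apply/existsP; exists k; rewrite lk mk eqxx.
Qed.

Lemma closerP n (m : {ffun 'I_n -> 'I_n}) v :
  reflect (m v < v /\ forall k : 'I_n, v < k -> m k <> m v) (closer m v).
Proof.
apply: (iffP andP) => -[lv H]; split=> //.
  by move=> k vk; apply/eqP; move/forallP/(_ k): H; rewrite vk.
by apply/forallP=> k; apply/implyP=> vk; apply/eqP/H.
Qed.

Lemma switchedP b n t (m : {ffun 'I_n -> 'I_n}) :
  reflect (minmap m /\ forall v o, closer m v -> o \in open_at m v ->
             if v < t then dir b (m v) o else dir b o (m v))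
    (m \in switched b n t).
Proof.
rewrite inE; apply: (iffP andP) => -[cm H]; split=> //.
  by move=> v o cv; move/forallP/(_ v)/implyP/(_ cv)/forall_inP: H; apply.
by apply/forallP=> v; apply/implyP=> cv; apply/forall_inP=> o; apply: H.
Qed.

Lemma dir_trans b n : transitive (@dir b n).
Proof. by case: b => y x z /=; lia. Qed.

Lemma dir_refl b n : reflexive (@dir b n).
Proof. by case: b => x /=. Qed.

Lemma dir_total b n : total (@dir b n).
Proof. by case: b => x y /=; lia. Qed.

Lemma dir_anti b n : antisymmetric (@dir b n).
Proof. by case: b => x y /= H; apply/val_inj => /=; lia. Qed.

(** * Cyclic renaming of the open blocks *)

(** The cyclic successor in A for the direction b: greatest element to least
    one, any other element to the next one, and the identity outside A. *)
Definition rotate b n (A : {set 'I_n}) : 'I_n -> 'I_n :=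
  next (sort (dir b) (enum A)).

Lemma rotate_out b n (A : {set 'I_n}) x : x \notin A -> rotate b A x = x.
Proof.
by move=> xA; rewrite /rotate next_nth mem_sort mem_enum (negbTE xA).
Qed.

Lemma rotate_in b n (A : {set 'I_n}) x : (rotate b A x \in A) = (x \in A).
Proof.
by move: (mem_next (sort (dir b) (enum A)) x); rewrite !mem_sort !mem_enum.
Qed.

Lemma rotate_inj b n (A : {set 'I_n}) : injective (rotate b A).
Proof. by apply/can_inj/prev_next; rewrite sort_uniq enum_uniq. Qed.

Lemma rotate_max b n (A : {set 'I_n}) x y :
  (forall z, z \in A -> dir b z x) -> x \in A -> y \in A ->
  dir b (rotate b A x) y.
Proof.
move=> xmax xA yA; rewrite /rotate next_nth mem_sort mem_enum xA.
have := sort_sorted (@dir_total b n) (enum A).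
have sA z : (z \in sort (dir b) (enum A)) = (z \in A).
  by rewrite mem_sort mem_enum.
have : uniq (sort (dir b) (enum A)) by rewrite sort_uniq enum_uniq.
case: (sort _ _) sA => [|h s] sA; first by rewrite -sA in xA.
move=> us hs; have hmin z : z \in A -> dir b h z.
  rewrite -sA inE => /predU1P[->|zs]; first exact: dir_refl.
  by move: zs; apply/allP: z; apply: order_path_min hs; apply: dir_trans.
rewrite nth_default ?hmin //.
(* the largest element comes last, where next wraps around to the head *)
suff -> : x = last h s by rewrite index_last.
apply: (@dir_anti b); rewrite xmax ?andbT; last by rewrite -sA mem_last.
apply: (sorted_leq_index (@dir_trans b n) (@dir_refl b n) hs).
- by rewrite sA.
- exact: mem_last.
- by rewrite index_last // -ltnS -[(size s).+1]/(size (h :: s)) index_mem sA.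
Qed.

(** The renaming is a step to the right in the sorted list of A, except at its
    end x. *)
Lemma rotate_mono b n (A : {set 'I_n}) x y z :
  (forall z, z \in A -> dir b z x) -> x \in A -> y \in A -> z \in A ->
  y != x -> z != x -> dir b y z -> dir b (rotate b A y) (rotate b A z).
Proof.
move=> xmax xA yA zA yx zx yz.
case: (eqVneq y z) => [->|neyz]; first exact: dir_refl.
rewrite /rotate !next_nth !mem_sort !mem_enum yA zA.
have := sort_sorted (@dir_total b n) (enum A).
have sA u : (u \in sort (dir b) (enum A)) = (u \in A).
  by rewrite mem_sort mem_enum.
have : uniq (sort (dir b) (enum A)) by rewrite sort_uniq enum_uniq.
case: (sort _ _) sA => [|h s] sA; first by rewrite -sA in xA.
move=> us hs; have idx u v : u \in A -> v \in A -> dir b u v -> u != v ->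
    index u (h :: s) < index v (h :: s).
  move=> uA vA uv neuv; rewrite ltnNge; apply/negP=> le; case/eqP: neuv.
  apply: (@dir_anti b); rewrite uv.
  by apply: (sorted_leq_index (@dir_trans b n) (@dir_refl b n) hs) le; rewrite sA.
have bound u : u \in A -> u != x -> index u (h :: s) < size s.
  move=> uA ux; rewrite -ltnS; apply: leq_trans (idx u x uA xA (xmax u uA) ux) _.
  by rewrite -ltnS -[(size s).+1]/(size (h :: s)) index_mem sA.
apply: (sorted_ltn_nth (@dir_trans b n) h (s := s)); rewrite ?inE ?bound ?idx //.
exact: path_sorted hs.
Qed.

(** Only the part of the partition from t on is renamed: the left halves of the
    blocks open at t are glued to their right halves in a new way. *)
Definition shift b n (t : 'I_n) (m : {ffun 'I_n -> 'I_n}) : {ffun 'I_n -> 'I_n} :=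
  [ffun i : 'I_n => if t <= i then rotate b (open_at m t) (m i) else m i].

Section Shift.
Context (b : bool) (n : nat) (t : 'I_n) (m : {ffun 'I_n -> 'I_n}).
Hypothesis cm : minmap m.
Let r := rotate b (open_at m t).
Let m' := shift b t m.

Lemma shift_lo (i : 'I_n) : i < t -> m' i = m i.
Proof. by move=> it; rewrite ffunE leqNgt it. Qed.

Lemma shift_hi (i : 'I_n) : t <= i -> m' i = r (m i).
Proof. by move=> it; rewrite ffunE it. Qed.

Lemma open_at_hi (i : 'I_n) : t <= i -> (m i \in open_at m t) = (m i < t).
Proof.
case/minmapP: cm => mle mid ti; apply/open_atP/idP => [[]|lt] //.
by split=> //; exists i.
Qed.

(** Renaming keeps blocks opened before t before t, so it is invisible to
    comparisons with any bound u >= t. *)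
Lemma rotate_lt (o : 'I_n) u : t <= u -> (r o < u) = (o < u).
Proof.
move=> tu; case: (boolP (o \in open_at m t)) => oA; last by rewrite /r rotate_out.
have /open_atP[lo _ _] := oA; have := oA; rewrite -(rotate_in b) -/r.
by case/open_atP=> lro _ _; lia.
Qed.

Lemma rotate_fix (o : 'I_n) : (m (r o) == r o) = (m o == o).
Proof.
case: (boolP (o \in open_at m t)) => oA; last by rewrite /r rotate_out.
have /open_atP[_ -> _] := oA; have := oA; rewrite -(rotate_in b) -/r.
by case/open_atP=> _ -> _; rewrite !eqxx.
Qed.

(** The renaming permutes the blocks open at t, and each of them has an element
    at or after t; so which blocks have elements after a given place before t
    does not change. *)
Lemma shift_used (o : 'I_n) u : u <= t -> o < t -> m o = o ->
  (exists2 k : 'I_n, u <= k & m' k = o) <-> (exists2 k : 'I_n, u <= k & m k = o).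
Proof.
move=> ut ot mo; split=> -[k uk mk].
  case: (ltnP k t) => kt; first by exists k; rewrite // -shift_lo.
  rewrite shift_hi // in mk.
  have : o \in open_at m t.
    by rewrite -mk rotate_in open_at_hi // -(rotate_lt _ (leqnn t)) mk.
  by case/open_atP=> _ _ [j tj mj]; exists j; rewrite // (leq_trans ut).
case: (ltnP k t) => kt; first by exists k; rewrite // shift_lo.
have oA : o \in open_at m t by apply/open_atP; split=> //; exists k.
have [o' ro'] : exists o', r o' = o.
  by exists (invF (@rotate_inj b n (open_at m t)) o); rewrite f_invF.
have : o' \in open_at m t by rewrite -(rotate_in b) -/r ro'.
case/open_atP=> _ _ [j tj mj]; exists j; first exact: leq_trans tj.
by rewrite shift_hi // mj.
Qed.

Lemma shift_minmap : minmap m'.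
Proof.
have /minmapP[mle mid] := cm.
have fixd (o : 'I_n) : m o = o -> m' o = o.
  move=> mo; case: (ltnP o t) => ot; first by rewrite shift_lo.
  by rewrite shift_hi // mo /r rotate_out // -[o in o \in _]mo open_at_hi // mo; lia.
apply/minmapP; split=> i.
  case: (ltnP i t) => it; first by rewrite shift_lo.
  by rewrite shift_hi // -ltnS rotate_lt ?ltnS // leqW.
case: (ltnP i t) => it; first by rewrite (shift_lo it) fixd.
by rewrite (shift_hi it) fixd //; apply/eqP; rewrite rotate_fix mid.
Qed.

Lemma shift_fix (o : 'I_n) : (m' o == o) = (m o == o).
Proof.
have /minmapP[mle mid] := cm.
case: (ltnP o t) => ot; first by rewrite shift_lo.
rewrite shift_hi //; have := open_at_hi ot; case: ltnP => mot oA.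
  have := rotate_lt (m o) (leqnn t); rewrite mot => rt.
  by apply/eqP/eqP=> E; move: ot; rewrite leqNgt -{1}E ?rt // mot.
by rewrite /r rotate_out ?oA.
Qed.

Lemma open_at_shift_lo u : u <= t -> open_at m' u = open_at m u.
Proof.
move=> ut; apply/setP=> o; apply/open_atP/open_atP.
  case=> ou /eqP; rewrite shift_fix => /eqP mo uk; split=> //.
  by apply/shift_used => //; apply: leq_trans ut.
case=> ou mo uk; split=> //; first by apply/eqP; rewrite shift_fix mo.
by apply/shift_used => //; apply: leq_trans ut.
Qed.

Lemma open_at_shift_hi u : t <= u -> open_at m' u = r @: open_at m u.
Proof.
have /minmapP[mle mid] := cm.
move=> tu; apply/setP=> o; apply/open_atP/imsetP.
  case=> ou _ [k uk mk]; rewrite shift_hi in mk; last exact: leq_trans uk.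
  exists (m k) => //; apply/open_atP; split=> //; last by exists k.
  by rewrite -(rotate_lt _ tu) mk.
case=> o' /open_atP[ou mo [k uk mk]] ->.
split; first by rewrite rotate_lt.
  by apply/eqP; rewrite shift_fix rotate_fix mo.
by exists k; rewrite // shift_hi ?mk //; apply: leq_trans uk.
Qed.

(** Elements keep their roles (opening, middle, closing): only the choice of an
    open block changes. *)
Lemma shift_closer v : closer m' v = closer m v.
Proof.
have /minmapP[mle mid] := cm.
case: (ltnP v t) => vt.
  have E : (exists2 k : 'I_n, v < k & m' k = m v) <-> (exists2 k : 'I_n, v < k & m k = m v).
    by apply: shift_used => //; apply: leq_ltn_trans vt.
  apply/closerP/closerP; rewrite shift_lo // => -[lv H]; split=> // k vk mk.
    by case: E => _ /(_ (ex_intro2 _ _ k vk mk)) [j vj]; apply: H.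
  by case: E => /(_ (ex_intro2 _ _ k vk mk)) [j vj] + _; apply: H.
apply/closerP/closerP; rewrite shift_hi // rotate_lt // => -[lv H]; split=> // k vk;
  have tk : t <= k by lia.
  by move=> mk; apply: (H k vk); rewrite shift_hi // mk.
by rewrite shift_hi // => /rotate_inj; apply: H.
Qed.

(** At t itself the greatest open block is renamed to the least one.  After t
    the former greatest block [m t] is closed, and the renaming is increasing on
    all remaining blocks, so the greatest open block stays the greatest. *)
Lemma shift_switched : closer m t -> m \in switched b n t ->
  m' \in switched b n t.+1.
Proof.
have /minmapP[mle mid] := cm.
move=> ct /switchedP[_ mX]; apply/switchedP; split; first exact: shift_minmap.
have /closerP[mt lastt] := ct.
have mtA : m t \in open_at m t by rewrite open_at_hi.
have tmax z : z \in open_at m t -> dir b z (m t).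
  by move=> zA; have := mX t z ct zA; rewrite ltnn.
move=> v o; rewrite shift_closer => cv.
case: (ltngtP v t) => [vt|vt|/val_inj ->]; last first.
- rewrite open_at_shift_hi // ltnSn => /imsetP[o' oA ->].
  by rewrite shift_hi //; apply: rotate_max => //; rewrite rotate_in.
- rewrite ltnS leqNgt vt /= open_at_shift_hi ?(ltnW vt) // => /imsetP[o' oA ->].
  rewrite shift_hi ?(ltnW vt) //.
  have := mX v o' cv oA; rewrite ltnNge (ltnW vt) /=.
  case/open_atP: oA => ov mo [k vk mk].
  have nt (j : 'I_n) : t < j -> m j != m t by move=> tj; apply/eqP/lastt.
  have tk : t < k by lia.
  subst o' => dkv.
  have := open_at_hi (ltnW vt); have := open_at_hi (ltnW tk).
  case: (ltnP (m k) t) => mkt; case: (ltnP (m v) t) => mvt kA vA.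
  - by apply: (rotate_mono tmax); rewrite ?kA ?vA ?nt.
  - rewrite [r (m v)]rotate_out ?vA //.
    by have := rotate_lt (m k) (leqnn t); rewrite mkt; move: dkv; case: (b) => /=; lia.
  - rewrite [r (m k)]rotate_out ?kA //.
    by have := rotate_lt (m v) (leqnn t); rewrite mvt; move: dkv; case: (b) => /=; lia.
  - by rewrite /r !rotate_out ?kA ?vA.
- rewrite ltnS (ltnW vt) open_at_shift_lo ?(ltnW vt) // shift_lo //.
  by move=> oA; have := mX v o cv oA; rewrite vt.
Qed.
End Shift.

(** When t closes no block the two conditions agree.  Otherwise the renaming
    applies, and it is injective because the set of open blocks at t, hence the
    renaming itself, can be read off the result. *)
Lemma card_switchedS b n (t : 'I_n) : #|switched b n t| <= #|switched b n t.+1|.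
Proof.
pose f (m : {ffun 'I_n -> 'I_n}) := if closer m t then shift b t m else m.
have finj : {in switched b n t &, injective f}.
  move=> m1 m2 /switchedP[c1 _] /switchedP[c2 _] E.
  have Ec : closer m1 t = closer m2 t.
    have := congr1 (fun m => closer m t) E; rewrite /f.
    by do 2![case: ifP]; rewrite ?shift_closer // => -> ->.
  move: E; rewrite /f Ec; case: ifP => // _ E.
  have Eo : open_at m1 t = open_at m2 t.
    by rewrite -(open_at_shift_lo b c1 (leqnn t)) E open_at_shift_lo.
  apply/ffunP=> i; have := congr1 (fun m : {ffun 'I_n -> 'I_n} => m i) E.
  by rewrite /= !ffunE Eo; case: ifP => // _ /rotate_inj.
rewrite -(card_in_imset finj); apply/subset_leq_card/subsetP=> _ /imsetP[m mX ->].
rewrite /f; case: ifP => ct.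
  by apply: shift_switched => //; case/switchedP: mX.
case/switchedP: mX => cm mX; apply/switchedP; split=> // v o cv oA.
have vt : v != t :> nat by apply: contraFneq ct => /val_inj <-.
by have := mX v o cv oA; rewrite ltnS [v <= t]leq_eqVlt (negbTE vt).
Qed.

(** After the last step every closing element follows the least-first
    discipline for b, which is the greatest-first one for the reversed order. *)
Lemma card_switched0 b n : #|switched b n 0| <= #|switched (~~ b) n 0|.
Proof.
have -> : switched (~~ b) n 0 = switched b n n.
  apply/setP=> m; apply/switchedP/switchedP => -[cm mX]; split=> // v o cv oA;
    by have := mX v o cv oA; rewrite ltn_ord; case: (b).
suff H k : k <= n -> #|switched b n 0| <= #|switched b n k| by exact: H.
elim: k => // k IH kn; apply: leq_trans (IH (ltnW kn)) _.
exact: (card_switchedS b (Ordinal kn)).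
Qed.

Lemma card_fifo_lifo n : #|switched false n 0| = #|switched true n 0|.
Proof. by apply/eqP; rewrite eqn_leq !card_switched0. Qed.

(** * Non-overlapping partitions close blocks last in, first out *)

Lemma setmin_eq n (A : {set 'I_n}) (a : 'I_n) :
  a \in A -> (forall i, i \in A -> a <= i) -> setmin A = a.
Proof.
move=> aA amin; apply/eqP; rewrite eqn_leq; apply/andP; split; last first.
  by rewrite /setmin; elim/big_ind: _ => [|x y|i] //; [exact: ltnW|lia|exact: amin].
have : a \in index_enum 'I_n by rewrite mem_index_enum.
rewrite /setmin; elim: (index_enum _) => // h r IH; rewrite inE big_cons.
case/predU1P=> [<-|/IH]; first by rewrite aA geq_minl.
by case: ifP => // _; lia.
Qed.

Lemma setmax_eq n (A : {set 'I_n}) (a : 'I_n) :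
  a \in A -> (forall i, i \in A -> i <= a) -> setmax A = a.
Proof.
move=> aA amax; apply/eqP; rewrite eqn_leq; apply/andP; split.
  exact/bigmax_leqP.
exact: (leq_bigmax_cond (F := fun i : 'I_n => i : nat)).
Qed.

Definition fibres n (m : {ffun 'I_n -> 'I_n}) : {set {set 'I_n}} :=
  preim_partition m [set: 'I_n].

Lemma fibresP n (m : {ffun 'I_n -> 'I_n}) (A : {set 'I_n}) :
  reflect (exists i, A = [set j | m i == m j]) (A \in fibres m).
Proof.
apply: (iffP imsetP) => [[i _ ->]|[i ->]]; exists i => //;
  by apply/setP=> j; rewrite !inE.
Qed.

Lemma fibre_last n (m : {ffun 'I_n -> 'I_n}) i :
  exists2 w : 'I_n, m w = m i & forall j, m j = m i -> j <= w.
Proof.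
case: (@arg_maxnP _ i (fun j => m j == m i) (fun j : 'I_n => j : nat)) => //.
by move=> w /eqP mw wmax; exists w => // j /eqP; apply: wmax.
Qed.

(** If blocks A and B overlap, with A opened first, then max A closes A while B,
    opened later, is still open; and conversely. *)
Lemma nonoverlapping_fibres n (m : {ffun 'I_n -> 'I_n}) : minmap m ->
  nonoverlapping (fibres m) = (m \in switched true n 0).
Proof.
move=> cm; have /minmapP[mle mid] := cm.
have minE i : setmin [set j | m i == m j] = m i.
  by apply: setmin_eq; rewrite ?inE ?mid // => j; rewrite inE => /eqP->.
have maxE i (w : 'I_n) : m w = m i -> (forall j, m j = m i -> j <= w) ->
    setmax [set j | m i == m j] = w.
  move=> mw wmax; apply: setmax_eq; first by rewrite inE mw.
  by move=> j; rewrite inE => /eqP/esym/wmax.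
apply/idP/switchedP => [/forall_inP no | [_ mX]].
  split=> // v o /closerP[mv lastv] /open_atP[ov mo [k vk mk]] /=.
  rewrite leqNgt; apply/negP=> mvo.
  have kv : v < k.
    by rewrite ltn_neqAle vk andbT; apply: contraTneq mvo => /val_inj->; rewrite mk ltnn.
  have [w mw wmax] := fibre_last m k.
  have Am : [set j | m v == m j] \in fibres m by apply/fibresP; exists v.
  have Bm : [set j | m k == m j] \in fibres m by apply/fibresP; exists k.
  move/forall_inP: (no _ Am) => /(_ _ Bm); rewrite /overlap !minE.
  rewrite (maxE v v) // ?(maxE k w) // ?mk ?mvo ?ov /=; last first.
    by move=> j mj; rewrite leqNgt; apply/negP=> /lastv.
  by rewrite (leq_trans kv) // wmax.
apply/forall_inP=> _ /fibresP[i ->]; apply/forall_inP=> _ /fibresP[j ->].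
rewrite /overlap !minE.
have [v mv vmax] := fibre_last m i; have [w mw wmax] := fibre_last m j.
rewrite (maxE _ _ mv vmax) (maxE _ _ mw wmax); apply/and3P=> -[ij jv vw].
have cv : closer m v.
  apply/closerP; rewrite mv; split; first exact: ltn_trans jv.
  by move=> k vk /vmax; rewrite leqNgt vk.
have oA : m j \in open_at m v by apply/open_atP; split=> //; exists w; rewrite // ltnW.
by have := mX v _ cv oA; rewrite /= mv leqNgt ij.
Qed.

Lemma mem_pblock_fibres n (m : {ffun 'I_n -> 'I_n}) x y :
  (y \in pblock (fibres m) x) = (m x == m y).
Proof.
rewrite /fibres /preim_partition pblock_equivalence_partition ?inE //.
by split=> // /eqP->.
Qed.

Lemma fibres_inj n : {in @minmap n &, injective (@fibres n)}.
Proof.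
move=> m1 m2 /minmapP[le1 id1] /minmapP[le2 id2] E.
have Em x y : (m1 x == m1 y) = (m2 x == m2 y).
  by rewrite -!mem_pblock_fibres E.
apply/ffunP=> x; apply/val_inj/eqP; rewrite /= eqn_leq.
have /eqP e1 : m1 x == m1 (m2 x) by rewrite Em id2.
have /eqP e2 : m2 x == m2 (m1 x) by rewrite -Em id1.
by rewrite {1}e1 le1 {1}e2 le2.
Qed.

Lemma fibres_onto n (P : {set {set 'I_n}}) : partition P [set: 'I_n] ->
  exists2 m, minmap m & fibres m = P.
Proof.
move=> partP; have /and3P[/eqP covP trivP _] := partP.
have inP x : x \in pblock P x by rewrite mem_pblock covP inE.
pose m := [ffun x : 'I_n => [arg min_(j < x in pblock P x) (j : nat)]].
have mP x : m x \in pblock P x /\ forall j, j \in pblock P x -> m x <= j.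
  by rewrite ffunE; case: arg_minnP => [|i iP imin]; rewrite ?inP.
have pm x : pblock P (m x) = pblock P x.
  by apply: same_pblock => //; case: (mP x).
have mE x y : (m x == m y) = (pblock P x == pblock P y).
  apply/eqP/eqP=> E; first by rewrite -pm E pm.
  apply/val_inj/eqP; rewrite /= eqn_leq.
  by rewrite (mP x).2 ?(mP y).2 // -?E ?(mP x).1 // E (mP y).1.
exists m.
  apply/minmapP; split=> i; first exact: (mP i).2.
  by apply/eqP; rewrite mE pm.
rewrite -(preim_partition_pblock partP) /fibres /preim_partition.
by apply: eq_imset => x; apply/setP=> y; rewrite !inE /= mE.
Qed.

Lemma card_lifo n : #|switched true n 0| = bessel n.
Proof.
have finj : {in switched true n 0 &, injective (@fibres n)}.
  by move=> m1 m2 /switchedP[c1 _] /switchedP[c2 _]; apply: fibres_inj.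
rewrite -(card_in_imset finj); apply: eq_card => P; rewrite inE.
apply/imsetP/andP=> [[m mX ->]|[/fibres_onto[m cm <-] no]].
  by case/switchedP: (mX) => cm _; rewrite nonoverlapping_fibres // preim_partitionP.
by exists m; rewrite // -nonoverlapping_fibres.
Qed.

(** * The two patterns, in terms of positions of letters *)

Notation pos s v := ((s^-1)%g v).

Definition triple n (x y z : 'I_n) : {ffun 'I_3 -> 'I_n} :=
  [ffun j : 'I_3 => tnth [tuple x; y; z] j].

Lemma contains_abcP n d1 d2 (s : 'S_n) :
  reflect (exists x y z : 'I_n,
             [/\ x < y < z, pos s x < pos s y < pos s z,
                 ~~ d1 -> pos s y = (pos s x).+1 :> nat
               & ~~ d2 -> pos s z = (pos s y).+1 :> nat])
    [exists t, subword (@GPattern [:: 0; 1; 2] [:: d1; d2] isT erefl) s t].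
Proof.
apply: (iffP existsP) => [[t /and3P[/forallP inc /forallP ord /forallP adj]]|].
  pose j0 : 'I_3 := inord 0; pose j1 : 'I_3 := inord 1; pose j2 : 'I_3 := inord 2.
  have E0 : j0 = 0 :> nat by rewrite inordK.
  have E1 : j1 = 1 :> nat by rewrite inordK.
  have E2 : j2 = 2 :> nat by rewrite inordK.
  exists (s (t j0)), (s (t j1)), (s (t j2)); rewrite !permK.
  have := forallP (inc j0) j1; have := forallP (inc j1) j2.
  have := forallP (ord j0) j1; have := forallP (ord j1) j2.
  have := forallP (adj j0) j1; have := forallP (adj j1) j2.
  rewrite /letter /dash E0 E1 E2 /= => a12 a01 /eqP-> /eqP-> -> ->; split=> // d.
    by apply/eqP; apply: (implyP a01).
  by apply/eqP; apply: (implyP a12).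
case=> x [y [z [/andP[xy yz] /andP[pxy pyz] d1P d2P]]].
exists (triple (pos s x) (pos s y) (pos s z)).
have xz := ltn_trans xy yz; have pxz := ltn_trans pxy pyz.
apply/and3P; split; apply/forallP=> -[[|[|[|//]]] ?];
  apply/forallP=> -[[|[|[|//]]] ?]; rewrite !ffunE /letter /dash /tnth /= ?permKV ?ltnn //.
- by rewrite xy.
- by rewrite xz.
- by rewrite ltnNge ltnW.
- by rewrite yz.
- by rewrite ltnNge ltnW.
- by rewrite ltnNge ltnW.
- by apply/implyP=> /d1P ->.
- by apply/implyP=> /d2P ->.
Qed.

Lemma avoidersP n (s : 'S_n) :
  reflect ((forall x y z : 'I_n, x < y < z -> pos s x < pos s y ->
              pos s z = (pos s y).+1 :> nat -> False) /\
           (forall x y z : 'I_n, x < y < z -> pos s y = (pos s x).+1 :> nat ->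
              pos s y < pos s z -> False))
    (s \in avoiders n a_bc ab_c).
Proof.
rewrite inE; apply: (iffP andP) => [[/contains_abcP no1 /contains_abcP no2]|[H1 H2]].
  split=> x y z xyz.
    by move=> pxy pz; apply: no1; exists x, y, z; rewrite pxy pz ltnSn.
  by move=> py pyz; apply: no2; exists x, y, z; rewrite pyz py ltnSn.
split; apply/contains_abcP=> -[x [y [z [xyz /andP[pxy pyz]]]]].
  by move=> _ /(_ isT); apply: H1 pxy.
by move=> /(_ isT) + _ => /(H2 x y z xyz); apply.
Qed.

(** * Permutations from orders on the letters *)

(** The lexicographic order that writes the blocks by decreasing minimum, and
    within a block the minimum first and then the other letters decreasingly;
    both components are at most n, which makes n.+1 a suitable radix. *)
Definition key n (m : {ffun 'I_n -> 'I_n}) (v : 'I_n) : nat :=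
  (n - m v) * n.+1 + (if m v == v then 0 else n - v).

Lemma ltn_key n (m : {ffun 'I_n -> 'I_n}) u v :
  (key m u < key m v) =
  (m v < m u) || [&& m u == m v, m v != v & (m u == u) || (v < u)].
Proof.
rewrite /key; have := ltn_ord (m u); have := ltn_ord (m v).
have := ltn_ord u; have := ltn_ord v.
case: (ltngtP (m u) (m v)) => [lt|lt|/val_inj E] un vn mun mvn.
- have -> : (m u == m v) = false by apply: contraTF lt => /eqP->; rewrite ltnn.
  by do 2!case: eqP => _ /=; nia.
- by do 2!case: eqP => _ /=; nia.
- rewrite E eqxx; have [->|nv] := eqVneq (m v) v; last by case: eqP => /= _; lia.
  by case: eqP => /= _; lia.
Qed.

Lemma key_inj n (m : {ffun 'I_n -> 'I_n}) : injective (key m).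
Proof.
move=> u v E; have := ltn_key m u v; have := ltn_key m v u.
rewrite E ltnn; case: (ltngtP (m u) (m v)) => // /val_inj Em.
rewrite Em eqxx /=; case: (eqVneq (m v) v) => [-> |nv] /=.
  by case: eqVneq => [->|] //=.
case: eqVneq => //= _; case: (ltngtP u v) => // /val_inj //.
Qed.

Lemma card_ltn_ord n k : k <= n -> #|[set w : 'I_n | w < k]| = k.
Proof.
move=> kn; rewrite -sum1_card -[RHS](card_ord k) -sum1_card (big_ord_widen n (fun=> 1) kn).
by apply: eq_bigl => i; rewrite inE.
Qed.

Lemma perm_order_inj n (s1 s2 : 'S_n) :
  (forall u v, (pos s1 u < pos s1 v) = (pos s2 u < pos s2 v)) -> s1 = s2.
Proof.
have posE (s : 'S_n) v : #|[set u | pos s u < pos s v]| = pos s v.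
  rewrite -[RHS](card_ltn_ord (ltnW (ltn_ord (pos s v)))).
  rewrite -(card_imset [set w : 'I_n | w < pos s v] (@perm_inj _ s)).
  congr #|pred_of_set _|; apply/setP=> u; rewrite inE; apply/idP/imsetP => [uv|[w + ->]].
    by exists (pos s u); rewrite ?inE ?permKV.
  by rewrite inE permK.
move=> E; apply: invg_inj; apply/permP=> v; apply/val_inj => /=.
by rewrite -[LHS]posE -[RHS]posE; apply: eq_card => u; rewrite !inE E.
Qed.

Lemma perm_of_key n (K : 'I_n -> nat) : injective K ->
  exists s : 'S_n, forall u v, (pos s u < pos s v) = (K u < K v).
Proof.
move=> Kinj; pose below v := [set w | K w < K v].
have lt_n v : #|below v| < n.
  rewrite -[X in _ < X]card_ord -cardsT; apply: proper_card.
  by rewrite properT; apply/negP=> /eqP/setP/(_ v); rewrite !inE ltnn.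
have mono u v : (#|below u| < #|below v|) = (K u < K v).
  apply/idP/idP => [|uv]; last first.
    apply: proper_card; apply/properP; split; last by exists u; rewrite inE ?ltnn.
    by apply/subsetP=> w; rewrite !inE => /ltn_trans; apply.
  apply: contraLR; rewrite -!leqNgt => vu; apply: subset_leq_card.
  by apply/subsetP=> w; rewrite !inE => /leq_trans; apply.
have rinj : injective (fun v => Ordinal (lt_n v)).
  move=> u v [E]; apply: Kinj; have := mono u v; have := mono v u.
  by rewrite E ltnn; case: ltngtP.
by exists (perm rinj)^-1%g => u v; rewrite invgK !permE /= mono.
Qed.

(** * Avoiding permutations close blocks first in, first out *)

(** The left-to-right minima cut the word into the blocks of a partition, each
    starting with its least letter, which names it. *)
Definition leftmin n (s : 'S_n) : {ffun 'I_n -> 'I_n} :=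
  [ffun v => [arg min_(u < v | pos s u <= pos s v) (u : nat)]].

Lemma leftminP n (s : 'S_n) v :
  pos s (leftmin s v) <= pos s v /\
  forall u, pos s u <= pos s v -> leftmin s v <= u.
Proof. by rewrite ffunE; case: arg_minnP => // i le H; split. Qed.

Lemma leftmin_anti n (s : 'S_n) u v :
  pos s u <= pos s v -> leftmin s v <= leftmin s u.
Proof.
by move=> uv; apply: (leftminP s v).2; apply: leq_trans (leftminP s u).1 uv.
Qed.

Lemma leftmin_between n (s : 'S_n) u w v : pos s u <= pos s w <= pos s v ->
  leftmin s u = leftmin s v -> leftmin s w = leftmin s v.
Proof.
case/andP=> /leftmin_anti uw /leftmin_anti wv E.
by apply/val_inj/eqP; rewrite /= eqn_leq wv -E uw.
Qed.

Lemma leftmin_id n (s : 'S_n) v : leftmin s (leftmin s v) = leftmin s v.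
Proof.
apply/val_inj/eqP; rewrite /= eqn_leq; apply/andP; split.
  exact: (leftminP s _).2.
by apply: leftmin_anti; apply: (leftminP s v).1.
Qed.

Lemma leftmin_minmap n (s : 'S_n) : minmap (leftmin s).
Proof.
by apply/minmapP; split=> v; [apply: (leftminP s v).2 | apply: leftmin_id].
Qed.

Lemma pos_inj n (s : 'S_n) u v : pos s u = pos s v :> nat -> u = v.
Proof. by move/val_inj/perm_inj. Qed.

(** Between two left-to-right minima there is no ascent: its bottom would have
    the smaller letter [leftmin s u] to its left, giving an a-bc subword. *)
Lemma leftmin_desc n (s : 'S_n) u v : s \in avoiders n a_bc ab_c ->
  leftmin s u = leftmin s v -> leftmin s u != u -> pos s u < pos s v -> v < u.
Proof.
case/avoidersP=> av _; set m := leftmin s => E nu.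
have [d Ed] : exists d, d = pos s v - (pos s u).+1 by exists (pos s v - (pos s u).+1).
elim: d v E Ed => [|d IH] v E Ed uv.
  have Ev : pos s v = (pos s u).+1 :> nat by lia.
  rewrite ltnNge leq_eqVlt; apply/negP=> /predU1P[/val_inj Euv|lt].
    by move: uv; rewrite Euv ltnn.
  have [pm mu] := leftminP s u; apply: (av (m u) u v) => //.
    by rewrite lt andbT ltn_neqAle nu mu.
  by rewrite ltn_neqAle pm andbT; apply: contra_neq nu => /pos_inj.
have lt : pos s v - 1 < n by have := ltn_ord (pos s v); lia.
(* w is the letter just before v. *)
pose w := s (Ordinal lt).
have pw : pos s w = (pos s v).-1 :> nat by rewrite permK /= subn1.
have uw : pos s u < pos s w by rewrite pw; lia.
have Ew : m u = m w.
  by rewrite E; apply/esym/(leftmin_between _ E); rewrite (ltnW uw) pw leq_pred.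
have wu : w < u by apply: IH => //; rewrite pw; lia.
apply: ltn_trans wu; rewrite ltnNge leq_eqVlt; apply/negP=> /predU1P[/val_inj Ewv|vw].
  by move: pw; rewrite Ewv; lia.
have [pm mu] := leftminP s u.
apply: (av (m u) w v); [|exact: leq_ltn_trans pm uw|by rewrite pw; lia].
rewrite vw andbT ltn_neqAle Ew (leftminP s w).2 // andbT.
by apply: contraTneq uw => /val_inj <-; rewrite -leqNgt -Ew.
Qed.

(** An avoiding permutation is the word prescribed by its blocks, hence it can
    be recovered from them. *)
Lemma pos_key n (s : 'S_n) u v : s \in avoiders n a_bc ab_c ->
  (pos s u < pos s v) = (key (leftmin s) u < key (leftmin s) v).
Proof.
move=> av; have main x y : pos s x < pos s y -> key (leftmin s) x < key (leftmin s) y.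
  move=> xy; rewrite ltn_key; have := leftmin_anti (ltnW xy).
  rewrite leq_eqVlt => /predU1P[/val_inj E|-> //].
  rewrite -E eqxx ltnn /=; apply/andP; split.
    apply: contraTneq xy => Ey; rewrite -leqNgt -{1}Ey E.
    exact: (leftminP s x).1.
  by case: eqVneq => //=; rewrite E => nx; apply: (leftmin_desc av (esym E) nx xy).
apply/idP/idP; first exact: main.
rewrite ltnNge => lt; rewrite ltnNge leq_eqVlt; apply: contra lt.
by case/predU1P=> [/pos_inj->|/main/ltnW].
Qed.

(** If v closes its block while a block o opened earlier is still open, then the
    minimum of v's block is immediately followed by v, its greatest letter, and
    a later letter of block o exceeding v completes an ab-c subword. *)
Lemma leftmin_fifo n (s : 'S_n) : s \in avoiders n a_bc ab_c ->
  leftmin s \in switched false n 0.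
Proof.
move=> av; apply/switchedP; split; first exact: leftmin_minmap.
set m := leftmin s => v o /closerP[mv lastv] /open_atP[ov mo [k vk mk]] /=.
rewrite leqNgt; apply/negP=> lt.
have kv : v < k.
  by rewrite ltn_neqAle vk andbT; apply: contraTneq lt => /val_inj->; rewrite mk ltnn.
have pv : pos s (m v) < pos s v.
  rewrite ltn_neqAle (leftminP s v).1 andbT.
  by apply: contraTneq mv => /pos_inj->; rewrite ltnn.
have vk' : pos s v < pos s k.
  by rewrite ltnNge; apply: contraTN lt => /leftmin_anti; rewrite -/m mk -leqNgt.
(* w is the letter just after the minimum of v's block; it turns out to be v. *)
have [w pw] : exists w, pos s w = (pos s (m v)).+1 :> nat.
  have lt1 : (pos s (m v)).+1 < n by have := ltn_ord (pos s v); lia.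
  by exists (s (Ordinal lt1)); rewrite permK.
have Ew : m w = m v.
  by apply: (leftmin_between _ (leftmin_id s v)); rewrite pw leqnSn.
have nw : m v != w by apply/eqP=> E; move: pw; rewrite E; lia.
have Ewv : w = v.
  apply/(@pos_inj n s)/eqP; rewrite eqn_leq pw pv /=; rewrite leqNgt; apply/negP=> lt1.
  apply: (lastv w) => //; apply: (leftmin_desc av) => //; first by rewrite Ew.
  by rewrite pw.
have [_ /(_ (m v) v k)] := avoidersP s av; rewrite mv kv; apply=> //.
by rewrite -pw Ewv.
Qed.

(** In the word prescribed by a first-in-first-out partition the only ascents
    go from the minimum to the maximum of a block.  Everything to their left is
    in blocks with greater or equal minima, so there is no a-bc; a greater
    letter to the right would lie in a block opened earlier and not yet
    closed, so there is no ab-c. *)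
Lemma fifo_leftmin n (m : {ffun 'I_n -> 'I_n}) : m \in switched false n 0 ->
  exists2 s, s \in avoiders n a_bc ab_c & leftmin s = m.
Proof.
case/switchedP=> cm mX; have /minmapP[mle mid] := cm.
have [s sE] := perm_of_key (@key_inj n m).
have sle u v : (pos s u <= pos s v) = (key m u <= key m v) by rewrite leqNgt sE -leqNgt.
have anti u v : key m u <= key m v -> m v <= m u.
  by rewrite leqNgt ltn_key negb_or -leqNgt => /andP[].
exists s; last first.
  apply/ffunP=> v; apply/val_inj/eqP; rewrite /= eqn_leq; apply/andP; split.
    by apply: (leftminP s v).2; rewrite sle leqNgt ltn_key mid ltnn eqxx.
  by have := (leftminP s v).1; rewrite sle => /anti/leq_trans; apply.
(* No key lies strictly between those of letters in adjacent positions. *)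
have adj u v w : pos s v = (pos s u).+1 :> nat -> key m u < key m w ->
    ~~ (key m w < key m v) by rewrite -!sE -leqNgt => ->.
(* If v opened a block of its own, v < u would follow; if its block opened
   earlier, the minimum of that block would come between u and v.  So u and v
   share a block, which decreases after its minimum. *)
have asc u v : pos s v = (pos s u).+1 :> nat -> u < v ->
    m u = u /\ m v = u.
  move=> puv uv.
  have kuv : key m u < key m v by rewrite -sE puv.
  have Em : m u = m v.
    apply/val_inj/eqP; rewrite /= eqn_leq (anti u v (ltnW kuv)) andbT leqNgt.
    apply/negP=> lt.
    have := adj u v (m v) puv; rewrite [key m u < _]ltn_key mid lt => /(_ isT).
    rewrite ltn_key mid ltnn eqxx /= andbT negbK => /eqP Ev.
    by move: lt; rewrite Ev; have := mle u; lia.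
  move: kuv; rewrite ltn_key Em ltnn eqxx /= => /andP[_].
  by rewrite [v < u]ltnNge (ltnW uv) orbF => /eqP.
apply/avoidersP; split=> x y z /andP[xy yz].
  move=> pxy pz; have [my mz] := asc y z pz yz.
  move: pxy; rewrite sE => /ltnW/anti; rewrite my.
  by have := mle x; lia.
move=> py pyz; have [mx my] := asc x y py xy.
have cy : closer m y.
  apply/closerP; rewrite my; split=> // k yk mk.
  have := adj x y k py; rewrite !ltn_key mk mx my !eqxx ltnn /= yk orbT.
  have -> : x != k by apply: contraTneq yk => <-; rewrite -leqNgt ltnW.
  by move=> /(_ isT); rewrite andbT negbK => /eqP E; move: xy; rewrite E ltnn.
have kyz : key m y < key m z by rewrite -sE.
have mzx : m z < x.
  have := anti y z (ltnW kyz); rewrite my leq_eqVlt => /predU1P[/val_inj E|//].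
  by case/closerP: cy => _ /(_ z yz); rewrite my E.
have oA : m z \in open_at m y.
  by apply/open_atP; split; [apply: ltn_trans xy|exact: mid|exists z; rewrite // ltnW].
by have := mX y _ cy oA; rewrite /= my leqNgt mzx.
Qed.

Lemma card_avoiders_fifo n : #|avoiders n a_bc ab_c| = #|switched false n 0|.
Proof.
have inj : {in avoiders n a_bc ab_c &, injective (@leftmin n)}.
  move=> s1 s2 av1 av2 E; apply: perm_order_inj => u v.
  by rewrite !pos_key // E.
rewrite -(card_in_imset inj); apply: eq_card => m; apply/imsetP/idP.
  by case=> s av ->; apply: leftmin_fifo.
by case/fifo_leftmin=> s av <-; exists s.
Qed.

Lemma eq_card_bijective (S T : finType) : #|S| = #|T| -> exists f : S -> T, bijective f.
Proof.
move=> E; exists (fun x => enum_val (cast_ord E (enum_rank x))).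
exists (fun y => enum_val (cast_ord (esym E) (enum_rank y))) => x;
  by rewrite enum_valK ?cast_ordK ?cast_ordKV enum_rankK.
Qed.

Theorem corollary17 (n : nat) :
  (exists f : {P : {set {set 'I_n}} | P \in nonoverlapping_partitions n} ->
              {s : 'S_n | s \in avoiders n a_bc ab_c},
     bijective f) /\
  #|avoiders n a_bc ab_c| = bessel n.
Proof.
have E : #|avoiders n a_bc ab_c| = bessel n.
  by rewrite card_avoiders_fifo card_fifo_lifo card_lifo.
by split=> //; apply: eq_card_bijective; rewrite !card_sig E.
Qed.
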